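(* Let $X_N=\{x_0,\dots,x_N\}$, $W_N=\{w^{(N)}_0,\dots,w^{(N)}_N\}$ form an interpolatory quadrature rule, let $M\ge 1$, and let $x_{N+1},\dots,x_{N+M}\in\mathbb{R}$ be such that $x_0,\dots,x_{N+M}$ are pairwise distinct. For $j=N+1,\dots,N+M$ let $$\varepsilon_j=\mu_j-\sum_{k=0}^N x_k^j w^{(N)}_k .$$ Then $X_{N+M}=X_N\cup\{x_{N+1},\dots,x_{N+M}\}$ forms the nodal set of a positive interpolatory quadrature rule if and only if $$-\,\frac{\sum_{j=N+1}^{N+M}(-1)^{N+M-j}\,\varepsilon_j\,e_{N+M-j}(X_{N+M}\setminus\{x_k\})}{\prod_{j=0,\,j\neq k}^{N+M}(x_k-x_j)}\;\le\; w^{(N)}_k\qquad\text{for all } k=0,\dots,N+M,$$ where $w^{(N)}_k:=0$ for $k>N$.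
   Context: Let $\Omega=[a,b]$ with $-\infty\le a<b\le\infty$ (intersected with $\mathbb{R}$) and let $\rho\colon\Omega\to[0,\infty)$ be a density function all of whose moments $\mu_j=\int_\Omega x^j\rho(x)\,dx$, $j\ge 0$, are finite. A quadrature rule with $n+1$ nodes ($n\ge0$) consists of pairwise distinct real nodes $x_0,\dots,x_n$ and real weights $w_0,\dots,w_n$. It is called interpolatory if $\sum_{k=0}^n x_k^jw_k=\mu_j$ for all $j=0,\dots,n$ (so the weights are uniquely determined by the nodes and the moments), and it is called positive if all of its weights are non-negative, i.e. $w_k\ge0$ for all $k$. A finite set forms the nodal set of a positive interpolatory quadrature rule if there exist weights for which it becomes a positive interpolatory quadrature rule. Added nodes are allowed to be arbitrary real numbers (not necessarily in $\Omega$). Here $e_i$ denotes the $i$-th elementary symmetric polynomial: $e_i(y_0,\dots,y_n)=\sum_{0\le l_1<\dots<l_i\le n}y_{l_1}\cdots y_{l_i}$, with $e_0\equiv1$, and $e_i(X_{N+M}\setminus\{x_k\})=e_i(x_0,\dots,x_{k-1},x_{k+1},\dots,x_{N+M})$. *)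

(* Defs.v *)
From HB Require Import structures.
From mathcomp Require Import all_boot all_order all_algebra.
From mathcomp Require Import all_classical all_reals all_analysis.
(* Not imported: the notations of multinomials clash with those of
   MathComp-Analysis. *)
From mathcomp Require mpoly.

Set Implicit Arguments.
Unset Strict Implicit.
Unset Printing Implicit Defensive.

Import Order.TTheory GRing.Theory Num.Theory.

Local Open Scope classical_set_scope.
Local Open Scope ring_scope.

Section Quadrature.
Context {R : realType}.

(* [a, b] intersected with the reals; a and b may be infinite. *)
Definition Omega (a b : \bar R) : set R := [set x : R | (a <= x%:E <= b)%E].

(* Integrability of all the monomials against rho says that the moments are
   finite; the case j = 0 contains the measurability of rho on Omega a b. *)
Definition density (a b : \bar R) (rho : R -> R) : Prop :=
  (forall x, Omega a b x -> 0 <= rho x) /\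
  (forall j : nat,
     lebesgue_measure.-integrable (Omega a b)
       (fun x : R => (x ^+ j * rho x)%:E)).

Definition moment (a b : \bar R) (rho : R -> R) (j : nat) : R :=
  \int[lebesgue_measure]_(x in Omega a b) (x ^+ j * rho x).

Definition quad_error (mu : nat -> R) (n : nat) (x w : 'I_n.+1 -> R)
    (j : nat) : R :=
  mu j - \sum_(k < n.+1) x k ^+ j * w k.

Definition interpolatory (mu : nat -> R) (n : nat) (x w : 'I_n.+1 -> R) :
    Prop :=
  injective x /\
  (forall j : nat, (j <= n)%N -> \sum_(k < n.+1) x k ^+ j * w k = mu j).

Definition positive_weights (n : nat) (w : 'I_n.+1 -> R) : Prop :=
  forall k, 0 <= w k.

Definition positive_interpolatory_nodal_set (mu : nat -> R) (X : set R) :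
    Prop :=
  exists (n : nat) (x w : 'I_n.+1 -> R),
    [/\ range x = X, interpolatory mu x w & positive_weights w].

Definition esymm (n i : nat) (y : 'I_n -> R) : R :=
  mpoly.meval y (mpoly.mesym n R i).

(* Extension by zero of the N+1 weights to the M added indices. *)
Definition extend_weights (N M : nat) (w : 'I_N.+1 -> R)
    (k : 'I_(N.+1 + M)) : R :=
  match fintype.split k with inl i => w i | inr _ => 0 end.

End Quadrature.

(* Main.v *)
Require Import Defs.
From mathcomp Require Import all_boot all_order all_algebra.
From mathcomp Require Import all_classical all_reals all_analysis.

Set Implicit Arguments.
Unset Strict Implicit.
Unset Printing Implicit Defensive.

Import Order.TTheory GRing.Theory Num.Theory.

Local Open Scope classical_set_scope.
Local Open Scope ring_scope.

(* The differences d between the weights on all the nodes and the given weights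
   extended by zero solve the Vandermonde system sum_k x_k^j d_k = eps_j, whose
   right-hand side vanishes for j <= N. Lagrange interpolation inverts this
   system: d_k is the value on the k-th Lagrange basis polynomial of the
   functional sending X^j to eps_j, and Viete's formulas give the coefficients
   of that polynomial. *)

Section NodePoly.
Variables (F : fieldType) (n : nat) (x : 'I_n.+1 -> F).

(** The numerator of the [k]-th Lagrange basis polynomial. Indexing the remaining nodes through
    [lift k], not by a condition [j != k], makes them a family over ['I_n], the form in which
    elementary symmetric polynomials are evaluated. *)
Definition node_poly (k : 'I_n.+1) : {poly F} :=
  \prod_(l < n) ('X - (x (lift k l))%:P).

Lemma size_node_poly k : size (node_poly k) = n.+1.
Proof. by rewrite size_prod_XsubC /index_enum -enumT size_enum_ord. Qed.

Lemma horner_node_poly k :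
  (node_poly k).[x k] = \prod_(j < n.+1 | j != k) (x k - x j).
Proof.
rewrite horner_prod [RHS]big_mkcond (bigD1_ord k) //= eqxx mul1r.
by apply: eq_bigr => l _; rewrite hornerXsubC eq_sym neq_lift.
Qed.

Lemma horner_node_poly_neq i k : i != k -> (node_poly k).[x i] = 0.
Proof.
rewrite eq_sym => /unlift_some[l -> _]; rewrite horner_prod (bigD1 l) //=.
by rewrite hornerXsubC subrr mul0r.
Qed.

Hypothesis x_inj : injective x.

Lemma horner_node_poly_neq0 k : (node_poly k).[x k] != 0.
Proof.
rewrite horner_node_poly; apply/prodf_neq0 => j neq_jk.
by rewrite subr_eq0 (inj_eq x_inj) eq_sym.
Qed.

(** The difference of the two sides has degree at most [n] and vanishes at [n.+1] distinct nodes. *)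
Lemma lagrange_interpolation (p : {poly F}) : (size p <= n.+1)%N ->
  p = \sum_k (p.[x k] / (node_poly k).[x k]) *: node_poly k.
Proof.
move=> size_p; apply/eqP; rewrite -subr_eq0; apply/eqP.
apply: (@roots_geq_poly_eq0 _ _ (codom x)).
- apply/allP => _ /codomP[i ->]; rewrite rootE hornerD hornerN horner_sum.
  rewrite (bigD1 i) //=.  rewrite big1 => [|k neq_ki]; last first.
    by rewrite hornerZ [X in _ * X]horner_node_poly_neq ?mulr0 1?eq_sym.
  by rewrite hornerZ divfK ?horner_node_poly_neq0 // addr0 subrr.
- by rewrite map_inj_uniq ?enum_uniq.
- rewrite size_codom card_ord (leq_trans (size_polyD _ _)) // geq_max size_p.
  rewrite size_polyN (leq_trans (size_sum _ _ _)) //; apply/bigmax_leqP => k _.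
  by rewrite (leq_trans (size_scale_leq _ _)) // size_node_poly.
Qed.

Lemma vandermonde_systemP (d : 'I_n.+1 -> F) (e : nat -> F) :
  (forall j, (j <= n)%N -> \sum_k x k ^+ j * d k = e j) <->
  (forall k, d k =
     (\sum_(j < n.+1) e j * (node_poly k)`_j) / (node_poly k).[x k]).
Proof.
split=> [de k|de j le_jn].
  apply/(canRL (mulfK (horner_node_poly_neq0 k))).
  (* Only the term [i = k] survives in this sum; expanding [node_poly k] in monomials instead brings
     in the power sums, which are the [e j]. *)
  transitivity (\sum_i d i * (node_poly k).[x i]).
    rewrite (bigD1 k) //= big1 ?addr0 // => i neq_ik.
    by rewrite horner_node_poly_neq ?mulr0.
  under eq_bigr => i _ do rewrite horner_coef size_node_poly mulr_sumr.
  rewrite exchange_big; apply: eq_bigr => j _.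
  rewrite -de -1?ltnS // mulr_suml; apply: eq_bigr => i _.
  by rewrite mulrCA mulrC [d i * _]mulrC.
(* For the converse, the linear functional sending each ['X^i] to [e i] is applied to the Lagrange
   expansion of ['X^j]. *)
have /(congr1 (fun p : {poly F} => \sum_(i < n.+1) e i * p`_i)) /= :
    'X^j = \sum_k ('X^j.[x k] / (node_poly k).[x k]) *: node_poly k.
  by apply: lagrange_interpolation; rewrite size_polyXn.
move/esym.
under eq_bigr => i _ do rewrite coef_sum mulr_sumr.
rewrite exchange_big /= [RHS](bigD1 (Ordinal (le_jn : (j < n.+1)%N))) //=.
rewrite coefXn eqxx mulr1 [X in _ = _ + X]big1 ?addr0 => [<-|i]; last first.
  by rewrite -val_eqE coefXn /= => /negPf->; rewrite mulr0.
apply: eq_bigr => k _; rewrite de mulrA mulrAC mulr_sumr; apply: eq_bigr => i _.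
by rewrite coefZ hornerXn mulrCA.
Qed.

End NodePoly.

Lemma coef_node_poly (R : realType) (n : nat) (x : 'I_n.+1 -> R) (k : 'I_n.+1)
    (j : nat) : (j <= n)%N ->
  (node_poly x k)`_j =
    (-1) ^+ (n - j) * esymm (n - j) (fun l => x (lift k l)).
Proof.
move=> le_jn; pose cs := [tuple x (lift k l) | l < n].
have lt_nj : (n - j < n.+1)%N by rewrite ltnS leq_subr.
have -> : node_poly x k = \prod_(c <- cs) ('X - c%:P).
  by rewrite big_map big_enum.
(* Viete's formula counts coefficients down from the leading one, so it is used at index [n - j]. *)
have /= := mpoly.mroots_coeff cs (Ordinal lt_nj); rewrite subKn // => ->.
by congr (_ * mpoly.meval _ _); apply/funext => l; rewrite tnth_mktuple.
Qed.

Section PositiveNodalSet.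
Variables (R : realType) (mu : nat -> R).

(** Two injective enumerations of the same set differ by a bijection of the indices. This forces
    equal numbers of nodes, and the weights are carried along it. *)
Lemma positive_nodal_set_range n (x : 'I_n.+1 -> R) : injective x ->
  positive_interpolatory_nodal_set mu (range x) <->
  exists2 v, interpolatory mu x v & positive_weights v.
Proof.
move=> x_inj; split; last by case=> v xv v_ge0; exists n, x, v.
case=> m [y [v [eq_yx [y_inj yv] v_ge0]]].
have /choice[t yt] k : exists i, y i = x k.
  have [i _ yi] : range y (x k) by rewrite eq_yx; exists k.
  by exists i.
have /choice[s xs] i : exists k, x k = y i.
  have [k _ xk] : range x (y i) by rewrite -eq_yx; exists i.
  by exists k.
have t_bij : bijective t.
  by exists s => i; [apply: x_inj; rewrite xs yt|apply: y_inj; rewrite yt xs].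
have [eq_nm] : n.+1 = m.+1 by have := bij_eq_card t_bij; rewrite !card_ord.
exists (v \o t) => [|k]; last exact: v_ge0.
split=> // j le_jn; rewrite -yv -?eq_nm //.
rewrite [RHS](reindex t) /=; last exact: onW_bij.
by apply: eq_bigr => k _; rewrite yt.
Qed.

(** The weights [u] are a reference point: the interpolatory weights on [x] are [u] plus the
    solution of the Vandermonde system for the errors of [u], and the inequality says that this sum
    is non-negative. *)
Lemma positive_nodal_setP n (x u : 'I_n.+1 -> R) : injective x ->
  positive_interpolatory_nodal_set mu (range x) <->
  (forall k, - ((\sum_(j < n.+1) quad_error mu x u j * (node_poly x k)`_j)
                / (node_poly x k).[x k]) <= u k).
Proof.
move=> x_inj; rewrite (positive_nodal_set_range x_inj).
have correctionP v : interpolatory mu x v <-> forall k, v k - u k =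
    (\sum_(j < n.+1) quad_error mu x u j * (node_poly x k)`_j)
    / (node_poly x k).[x k].
  rewrite -vandermonde_systemP // /quad_error.
  have momentP j : \sum_k x k ^+ j * (v k - u k) = mu j - \sum_k x k ^+ j * u k
      <-> \sum_k x k ^+ j * v k = mu j.
    under eq_bigr => k _ do rewrite mulrBr.
    by rewrite sumrB; split=> [/addIr|->].
  split=> [[_ xv] j /xv /momentP //|xv]; split=> // j /xv /momentP //.
split=> [[v /correctionP xv v_ge0] k|u_ge].
  by rewrite -xv opprB lerBlDr lerDl.
exists (fun k => u k +
    (\sum_(j < n.+1) quad_error mu x u j * (node_poly x k)`_j)
    / (node_poly x k).[x k]) => [|k]; last by rewrite -lerBlDr sub0r.
by apply/correctionP => k; rewrite addrC addKr.
Qed.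

Lemma quad_error_extend_weights N M (x : 'I_(N.+1 + M) -> R) (w : 'I_N.+1 -> R)
    j :
  quad_error mu (n := (N + M)%N) x (extend_weights w) j =
  quad_error mu (fun l => x (lshift M l)) w j.
Proof.
congr (_ - _); rewrite (@big_split_ord _ _ _ N.+1 M) /= [X in _ + X]big1 ?addr0.
  by apply: eq_bigr => i _; rewrite /extend_weights (unsplitK (inl i)).
by move=> i _; rewrite /extend_weights (unsplitK (inr i)) mulr0.
Qed.

Lemma quad_error_interpolatory n (x w : 'I_n.+1 -> R) j :
  interpolatory mu x w -> (j <= n)%N -> quad_error mu x w j = 0.
Proof. by case=> _ xw /xw; rewrite /quad_error => ->; rewrite subrr. Qed.

End PositiveNodalSet.

Theorem theorem7 (R : realType) (a b : \bar R) (hab : (a < b)%E)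
    (rho : R -> R) (hrho : density a b rho)
    (N M : nat) (hM : (1 <= M)%N)
    (x : 'I_(N.+1 + M) -> R) (hx : injective x)
    (w : 'I_N.+1 -> R)
    (hw : interpolatory (moment a b rho) (fun k => x (lshift M k)) w) :
  positive_interpolatory_nodal_set (moment a b rho) (range x) <->
  (forall k : 'I_(N.+1 + M),
     - ((\sum_(N.+1 <= j < (N + M).+1)
           (-1) ^+ (N + M - j)
           * quad_error (moment a b rho) (fun l => x (lshift M l)) w j
           * esymm (N + M - j) (fun l : 'I_(N + M) => x (lift k l)))
        / \prod_(j < N.+1 + M | j != k) (x k - x j))
     <= extend_weights w k).
Proof.
(* The types ['I_(N.+1 + M)] and ['I_(N + M).+1] are convertible, which is why [n] is given
   explicitly as [N + M]. *)
rewrite (@positive_nodal_setP _ _ (N + M)%N x (extend_weights w) hx).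
set mu := moment a b rho in hw *.
suff correctionE k :
    \sum_(j < (N + M).+1) quad_error mu (n := (N + M)%N) x (extend_weights w) j
       * (node_poly (n := (N + M)%N) x k)`_j =
    \sum_(N.+1 <= j < (N + M).+1) (-1) ^+ (N + M - j)
       * quad_error mu (fun l => x (lshift M l)) w j
       * esymm (N + M - j) (fun l : 'I_(N + M) => x (lift k l)).
  by split=> H k; have := H k; rewrite correctionE horner_node_poly.
rewrite -(big_mkord xpredT (fun j => quad_error mu (n := (N + M)%N) x
  (extend_weights w) j * (node_poly (n := (N + M)%N) x k)`_j)).
(* The given rule is exact up to degree [N], so the errors with [j <= N] drop out and the sum starts
   at [N.+1]. *)
rewrite (big_cat_nat (n := N.+1)) ?ltnS ?leq_addr //= big_nat big1 ?add0r.
  rewrite big_nat [RHS]big_nat; apply: eq_bigr => j /andP[_ lt_jNM].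
  by rewrite quad_error_extend_weights coef_node_poly // mulrCA mulrA.
move=> j /andP[_ lt_jN].
by rewrite quad_error_extend_weights (quad_error_interpolatory hw) ?mul0r.
Qed.
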